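(* Let $A$ be a unital associative $*$-algebra over $\mathbb{C}$, $\varepsilon\colon A\to\mathbb{C}$ a character, $K_1=\ker\varepsilon$, and $\mu\colon K_1\otimes_AK_1\to K_1$, $\mu(a\otimes b)=ab$. \begin{enumerate} \item Let $\varphi\colon K_1\otimes_AK_1\to\mathbb{C}$ be linear. There exists a linear functional $\psi\colon A\to\mathbb{C}$ with $\psi(1)=0$ and $\psi(ab)=\varphi(a\otimes b)$ for all $a,b\in K_1$ if and only if $\varphi$ vanishes on the range of the map $p\colon H_2(A,\mathbb{C})\to K_1\otimes_AK_1$, which coincides with $\ker\mu$. In this case $\psi$ is determined by $\varphi$ up to a linear functional on $H_1(A,\mathbb{C})$. \item $H_2(A,\mathbb{C})=\{0\}$ if and only if $H^2(A,\mathbb{C})=\{0\}$. \item Let $\pi\colon A\to L(D)$ be a unital $*$-representation on a pre-Hilbert space $D$ and $\eta\colon A\to D$ a $\pi$-$\varepsilon$-cocycle. Then $\eta$ admits a generating functional if and only if $\mathcal{K}(\eta)$ vanishes on $\ker\mu$. \item If $H^2(A,\mathbb{C})=\{0\}$, then $(A,\varepsilon)$ has property (AC). \end{enumerate}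
   Context: A character is a non-zero $*$-homomorphism $\varepsilon\colon A\to\mathbb{C}$. A pre-Hilbert space is a complex vector space with a positive definite inner product, linear in the second argument; $L(D)$ is the $*$-algebra of adjointable linear operators $D\to D$. $H^n(A,\mathbb{C})$ and $H_n(A,\mathbb{C})$ are Hochschild cohomology and homology with coefficients in the bimodule $\mathbb{C}$ with actions $a.z.b=\varepsilon(a)z\varepsilon(b)$. Explicitly, $H_n(A,\mathbb{C})$ is the homology of $C_n=A^{\otimes n}$ with $d(a_1\otimes\cdots\otimes a_n)=\varepsilon(a_1)a_2\otimes\cdots\otimes a_n+\sum_{i=1}^{n-1}(-1)^i a_1\otimes\cdots\otimes a_ia_{i+1}\otimes\cdots\otimes a_n+(-1)^n\varepsilon(a_n)a_1\otimes\cdots\otimes a_{n-1}$, and $H^n(A,\mathbb{C})$ is the cohomology of the algebraic dual complex, $\partial\phi=\phi\circ d$. The map $p\colon H_2(A,\mathbb{C})\to K_1\otimes_AK_1$ is induced by $a\otimes b\mapsto(a-\varepsilon(a)1)\otimes(b-\varepsilon(b)1)$. Every element of $A=C_1$ is a 1-cycle, so a linear functional on $H_1(A,\mathbb{C})$ is viewed as a linear functional on $A$ via $a\mapsto[a]$. A $\pi$-$\varepsilon$-cocycle is a linear map $\eta\colon A\to D$ with $\eta(ab)=\pi(a)\eta(b)+\eta(a)\varepsilon(b)$ for all $a,b\in A$. $\mathcal{K}(\eta)\colon K_1\otimes_AK_1\to\mathbb{C}$ is the (unique, well-defined) linear map with $\mathcal{K}(\eta)(a\otimes b)=\langle\eta(a^*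 ),\eta(b)\rangle$ for $a,b\in K_1$. A Schürmann triple $(\pi,\eta,\psi)$ consists of a unital $*$-representation $\pi\colon A\to L(D)$ on a pre-Hilbert space $D$, a $\pi$-$\varepsilon$-cocycle $\eta\colon A\to D$, and a hermitian linear functional $\psi\colon A\to\mathbb{C}$ (i.e. $\psi(a^* )=\overline{\psi(a)}$) with $\varepsilon(a)\psi(b)-\psi(ab)+\psi(a)\varepsilon(b)=-\langle\eta(a^* ),\eta(b)\rangle$ for all $a,b\in A$. The cocycle $\eta$ admits a generating functional if there is $\psi$ making $(\pi,\eta,\psi)$ a Schürmann triple. Property (AC): for every unital $*$-representation $\pi$ of $A$ on a pre-Hilbert space and every $\pi$-$\varepsilon$-cocycle $\eta$ there is $\psi$ such that $(\pi,\eta,\psi)$ is a Schürmann triple. *)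

(* Defs.v *)
From HB Require Import structures.
From mathcomp Require Import all_boot all_order all_algebra.
From mathcomp Require Import boolp functions reals.
From mathcomp Require Import finmap complex monalg.

Set Implicit Arguments.
Unset Strict Implicit.
Unset Printing Implicit Defensive.

Import GRing.Theory Num.Theory.
Local Open Scope ring_scope.
Local Open Scope quotient_scope.

(* Seals definitions against unfolding during unification. *)
Fact lock_key : unit. Proof. by []. Qed.

Section Span.
Variables (C : numClosedFieldType) (V : lmodType C) (G : V -> Prop).

Inductive in_span : V -> Prop :=
| in_span0 : in_span 0
| in_spanD c u v : G u -> in_span v -> in_span (c *: u + v).

Definition spanp : {pred V} := [pred v | `[< in_span v >]].

Lemma spanpP v : reflect (in_span v) (v \in spanp).
Proof. by rewrite inE; apply: asboolP. Qed.

Lemma spanp_closed : submod_closed spanp.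
Proof.
split; first by apply/spanpP; exact: in_span0.
move=> a u v /spanpP su /spanpP sv; apply/spanpP.
elim: su => [|c w w' Gw _ IH]; first by rewrite scaler0 add0r.
by rewrite scalerDr scalerA -addrA; apply: in_spanD.
Qed.

HB.instance Definition _ := GRing.isSubmodClosed.Build C V spanp spanp_closed.

Lemma mem_spanp v : G v -> v \in spanp.
Proof.
move=> Gv; apply/spanpP; rewrite -[v]addr0 -[v]scale1r.
by apply: in_spanD => //; exact: in_span0.
Qed.

End Span.

(* [lquot G] is the quotient of [V] by the subspace spanned by [G]. *)
Section LQuot.
Variables (C : numClosedFieldType) (V : lmodType C) (G : V -> Prop).

Definition lquot := Quotient.quot (spanp G : zmodClosed V).

HB.instance Definition _ := GRing.Zmodule.on lquot.
HB.instance Definition _ := EqQuotient.on lquot.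

Definition cls : V -> lquot :=
  locked_with lock_key (\pi_(Quotient.quot (spanp G : zmodClosed V))).

Lemma cls_eq u v : (cls u = cls v) <-> (u - v \in spanp G).
Proof.
by rewrite /cls unlock Quotient.idealrBE; split=> [->|/eqP].
Qed.

Lemma clsD : {morph cls : u v / u + v}.
Proof. by move=> u v; rewrite /cls unlock raddfD. Qed.

Lemma cls_repr (q : lquot) : cls (repr q) = q.
Proof. by rewrite /cls unlock reprK. Qed.

Definition lquot_scale : C -> lquot -> lquot :=
  locked_with lock_key (fun a q => cls (a *: repr q)).

Lemma lquot_scaleE a v : lquot_scale a (cls v) = cls (a *: v).
Proof.
rewrite /lquot_scale unlock; apply/cls_eq; rewrite -scalerBr rpredZ //; apply/cls_eq.
exact: cls_repr.
Qed.

Let scaleA a b q : lquot_scale a (lquot_scale b q) = lquot_scale (a * b) q.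
Proof. by rewrite -[q]cls_repr !lquot_scaleE scalerA. Qed.
Let scale1 : left_id 1 lquot_scale.
Proof. by move=> q; rewrite -[q]cls_repr !lquot_scaleE scale1r. Qed.
Let scaleDr : right_distributive lquot_scale +%R.
Proof.
move=> a q r; rewrite -[q]cls_repr -[r]cls_repr.
by rewrite -clsD !lquot_scaleE scalerDr clsD.
Qed.
Let scaleDl q : {morph lquot_scale^~ q : a b / a + b}.
Proof. by move=> a b; rewrite -[q]cls_repr !lquot_scaleE scalerDl clsD. Qed.

HB.instance Definition _ :=
  GRing.Zmodule_isLmodule.Build C lquot scaleA scale1 scaleDr scaleDl.

Lemma cls_is_linear : linear cls.
Proof. by move=> a u v; rewrite clsD -lquot_scaleE. Qed.

HB.instance Definition _ := GRing.isLinear.Build C V lquot _ cls cls_is_linear.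

Lemma cls_lin a u v w : G (w - (a *: u + v)) -> cls w = a *: cls u + cls v.
Proof. by move=> Gw; rewrite -linearP; apply/cls_eq/mem_spanp. Qed.

Section Lift.
Variables (W : lmodType C) (f : {linear V -> W}) (fG : forall v, G v -> f v = 0).

Definition lquot_lift of (forall v, G v -> f v = 0) :=
  locked_with lock_key (fun q : lquot => f (repr q)).

Lemma lift_span v : v \in spanp G -> f v = 0.
Proof.
move=> /spanpP; elim=> [|c u w Gu _ IH]; first exact: linear0.
by rewrite linearP fG // IH scaler0 addr0.
Qed.

Lemma lquot_liftE v : lquot_lift fG (cls v) = f v.
Proof.
rewrite /lquot_lift unlock; apply/eqP; rewrite -subr_eq0 -linearB; apply/eqP/lift_span/cls_eq.
exact: cls_repr.
Qed.

Lemma lquot_lift_linear : linear (lquot_lift fG).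
Proof.
move=> a q r; rewrite -[q]cls_repr -[r]cls_repr -linearP !lquot_liftE.
exact: linearP.
Qed.

HB.instance Definition _ :=
  GRing.isLinear.Build C lquot W _ (lquot_lift fG) lquot_lift_linear.
End Lift.
End LQuot.

Section FreeLift.
Variables (C : numClosedFieldType) (T : choiceType) (W : lmodType C) (f : T -> W).

Definition free_lift : {malg C[T]} -> W :=
  locked_with lock_key (fun g => \sum_(t <- msupp g) g@_t *: f t).

Lemma free_liftEw (g : {malg C[T]}) (d : {fset T}) : (msupp g `<=` d)%fset ->
  free_lift g = \sum_(t <- d) g@_t *: f t.
Proof.
move=> gd; rewrite /free_lift unlock; apply: big_fset_incl => // t _ /mcoeff_outdom->.
exact: scale0r.
Qed.

Lemma free_lift_linear : linear free_lift.
Proof.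
move=> a g h; pose d := (msupp g `|` msupp h `|` msupp (a *: g + h))%fset.
rewrite !(@free_liftEw _ d) ?fsubsetUr //; last 2 first.
- by rewrite /d fsetUAC fsubsetUr.
- by rewrite /d -fsetUA fsubsetUl.
rewrite scaler_sumr -big_split /=; apply: eq_bigr => t _.
by rewrite mcoeffD mcoeffZ scalerDl scalerA.
Qed.

HB.instance Definition _ :=
  GRing.isLinear.Build C {malg C[T]} W _ free_lift free_lift_linear.

Lemma free_liftE t : free_lift << t >> = f t.
Proof. by rewrite /free_lift unlock msuppU oner_eq0 big_seq_fset1 mcoeffUU scale1r. Qed.

Lemma free_liftB s t : free_lift (<< s >> - << t >>) = f s - f t.
Proof. by rewrite linearB /= !free_liftE. Qed.

Lemma free_lift_lin a r s t :
  free_lift (<< r >> - (a *: << s >> + << t >>)) = f r - (a *: f s + f t).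
Proof. by rewrite linearB linearP /= !free_liftE. Qed.

Lemma free_lin_eq (f1 f2 : {linear {malg C[T]} -> W}) :
  (forall t, f1 << t >> = f2 << t >>) -> f1 =1 f2.
Proof.
move=> f12 g; rewrite [g]monalgE !linear_sum; apply: eq_bigr => t _.
have -> : << g@_t *g t >> = g@_t *: << t >> :> {malg C[T]}.
  by apply/malgP => u; rewrite mcoeffZ !mcoeffU mulrnAr mulr1.
by rewrite !linearZ /= f12.
Qed.

End FreeLift.

Section Kernel.
Variables (C : numClosedFieldType) (U V : lmodType C) (f : {linear U -> V}).

Definition kerp : {pred U} := [pred u | f u == 0].

Lemma kerp_closed : submod_closed kerp.
Proof.
split=> [|a u v]; rewrite !inE ?linear0 // => /eqP fu /eqP fv.
by rewrite linearP fu fv scaler0 addr0.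
Qed.

HB.instance Definition _ := GRing.isSubmodClosed.Build C U kerp kerp_closed.

Definition kerT := {u : U | u \in kerp}.

HB.instance Definition _ := SubChoice.on kerT.
HB.instance Definition _ := [SubChoice_isSubLmodule of kerT by <:].

Lemma kerTP (u : kerT) : f (val u) = 0.
Proof. exact/eqP/(valP u). Qed.

End Kernel.

Section Dual.
Variables (C : numClosedFieldType) (U : lmodType C).

Definition linearp : {pred U -> C^o} := [pred f : U -> C^o | `[< linear f >]].

Lemma linearp_closed : submod_closed linearp.
Proof.
split; first by apply/asboolP => a u v /=; rewrite scaler0 addr0.
move=> a f g /asboolP lf /asboolP lg; apply/asboolP => b u v.
have E x : (a *: f + g) x = a *: f x + g x by [].
rewrite !E lf lg !scalerDr !scalerA (mulrC a) -!addrA; congr (_ + _).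
by rewrite addrCA.
Qed.

HB.instance Definition _ :=
  GRing.isSubmodClosed.Build C (U -> C^o) linearp linearp_closed.

Definition dual := {f : U -> C^o | f \in linearp}.

HB.instance Definition _ := SubChoice.on dual.
HB.instance Definition _ := [SubChoice_isSubLmodule of dual by <:].

Definition dual_fun (f : dual) : U -> C^o := val f.

Lemma dual_fun_linear f : linear (dual_fun f).
Proof. exact/asboolP/(valP f). Qed.

HB.instance Definition _ f :=
  GRing.isLinear.Build C U C^o _ (dual_fun f) (dual_fun_linear f).

End Dual.

Section DualMap.
Variables (C : numClosedFieldType) (U V : lmodType C) (f : {linear U -> V}).

Lemma dual_map_subproof (phi : dual V) : dual_fun phi \o f \in @linearp C U.
Proof. by apply/asboolP => a u v /=; rewrite !linearP. Qed.

Definition dual_map (phi : dual V) : dual U :=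
  exist _ (dual_fun phi \o f) (dual_map_subproof phi).

Lemma dual_map_linear : linear dual_map.
Proof. by move=> a phi chi; apply: val_inj; apply/funext => u. Qed.

HB.instance Definition _ :=
  GRing.isLinear.Build C (dual V) (dual U) _ dual_map dual_map_linear.
End DualMap.

(* [homology f g] is [ker g / im f]; the relation keeps only the elements of
   [im f] that lie in [ker g], and no assumption [g \o f = 0] is needed. *)
Definition homology (C : numClosedFieldType) (U V W : lmodType C)
    (f : {linear U -> V}) (g : {linear V -> W}) :=
  lquot (fun z : kerT g => exists u, f u = val z).

(* Short tuples under a head constant, so that unification compares the entries
   and not the size proofs. *)
Definition tup1 (T : Type) (a : T) : 1.-tuple T := [tuple a].
Definition tup2 (T : Type) (a b : T) : 2.-tuple T := [tuple a; b].

Section TensorPower.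
Variables (C : numClosedFieldType) (A : algType C).

Definition tuple_upd n (t : n.-tuple A) (i : 'I_n) (x : A) : n.-tuple A :=
  [tuple if j == i then x else tnth t j | j < n].

Definition multilinear n (W : lmodType C) (f : n.-tuple A -> W) : Prop :=
  forall t i a x y, f (tuple_upd t i (a *: x + y)) =
    a *: f (tuple_upd t i x) + f (tuple_upd t i y).

Variant multilinear_rel n : {malg C[n.-tuple A]} -> Prop :=
| MultilinearRel t i a x y : multilinear_rel
    (<< tuple_upd t i (a *: x + y) >>
     - (a *: << tuple_upd t i x >> + << tuple_upd t i y >>)).

Definition tpow n := lquot (@multilinear_rel n).

HB.instance Definition _ n := GRing.Lmodule.on (tpow n).

Definition tens n : n.-tuple A -> tpow n :=
  locked_with lock_key (fun t => cls (@multilinear_rel n) << t >>).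

Lemma tens_multilinear n : multilinear (@tens n).
Proof.
by move=> t i a x y; rewrite /tens unlock; apply: cls_lin; exact: MultilinearRel.
Qed.

Section Lift.
Variables (n : nat) (W : lmodType C) (f : n.-tuple A -> W).

Lemma tpow_lift_rel : multilinear f ->
  forall g, multilinear_rel g -> free_lift f g = 0.
Proof.
by move=> fM _ [t i a x y]; rewrite free_lift_lin fM subrr.
Qed.

Definition tpow_lift (fM : multilinear f) : tpow n -> W :=
  lquot_lift (tpow_lift_rel fM).

Variable fM : multilinear f.

HB.instance Definition _ := GRing.Linear.on (tpow_lift fM).

Lemma tpow_liftE t : tpow_lift fM (tens t) = f t.
Proof. by rewrite /tpow_lift /tens unlock lquot_liftE /= free_liftE. Qed.

End Lift.

Lemma tpow_lin_eq n (W : lmodType C) (f g : {linear tpow n -> W}) :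
  (forall t, f (tens t) = g (tens t)) -> f =1 g.
Proof.
move=> fg x; rewrite -[x]cls_repr; rewrite /tens unlock in fg.
exact: (@free_lin_eq _ _ _ (f \o cls _) (g \o cls _)).
Qed.

Lemma tnth_upd n (t : n.-tuple A) i x j :
  tnth (tuple_upd t i x) j = if j == i then x else tnth t j.
Proof. by rewrite tnth_mktuple. Qed.

Lemma multilinearD n (W : lmodType C) (f g : n.-tuple A -> W) :
  multilinear f -> multilinear g -> multilinear (fun t => f t + g t).
Proof. by move=> fM gM t i a x y; rewrite fM gM scalerDr addrACA. Qed.

Lemma multilinearZ n (W : lmodType C) c (f : n.-tuple A -> W) :
  multilinear f -> multilinear (fun t => c *: f t).
Proof.
by move=> fM t i a x y; rewrite fM scalerDr !scalerA (mulrC c).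
Qed.

Lemma multilinear_sum n (W : lmodType C) (I : Type) (r : seq I)
    (f : I -> n.-tuple A -> W) :
  (forall i, multilinear (f i)) -> multilinear (fun t => \sum_(i <- r) f i t).
Proof.
move=> fM t i a x y; rewrite scaler_sumr -big_split.
by apply: eq_bigr => j _; rewrite fM.
Qed.

End TensorPower.

Section Hochschild.
Variables (C : numClosedFieldType) (A : algType C) (eps : {linear A -> C^o}).

Definition drop_first n (t : n.+1.-tuple A) : n.-tuple A :=
  [tuple tnth t (lift ord0 j) | j < n].
Definition drop_last n (t : n.+1.-tuple A) : n.-tuple A :=
  [tuple tnth t (lift ord_max j) | j < n].
(* Replaces the adjacent entries at positions [m] and [m + 1], counted from 0,
   by their product. *)
Definition merge n (m : 'I_n) (t : n.+1.-tuple A) : n.-tuple A :=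
  [tuple if (j < m)%N then tnth t (lift ord_max j)
         else if j == m then tnth t (lift ord_max j) * tnth t (lift ord0 j)
         else tnth t (lift ord0 j) | j < n].

(* Positions are counted from 0, hence the exponent [m.+1] of the sign. *)
Definition bd_tuple n (t : n.+1.-tuple A) : tpow A n :=
  eps (tnth t ord0) *: tens (drop_first t)
  + \sum_(m < n) (-1) ^+ m.+1 *: tens (merge m t)
  + (-1) ^+ n.+1 *: (eps (tnth t ord_max) *: tens (drop_last t)).

Let lin_at n (g : n.+1.-tuple A -> n.-tuple A) i :
  (forall t, exists j (h : {linear A -> A}),
     forall x, g (tuple_upd t i x) = tuple_upd (g t) j (h x)) ->
  forall t a x y, tens (g (tuple_upd t i (a *: x + y))) =
    a *: tens (g (tuple_upd t i x)) + tens (g (tuple_upd t i y)).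
Proof.
by move=> gP t a x y; have [j [h E]] := gP t; rewrite !E linearP tens_multilinear.
Qed.

Lemma drop_multilinear n (o : 'I_n.+1) :
  multilinear (fun t : n.+1.-tuple A =>
    eps (tnth t o) *: tens [tuple tnth t (lift o j) | j < n]).
Proof.
move=> t i a x y; have [->|io] := eqVneq i o.
  rewrite !tnth_upd eqxx linearP.
  have E z : [tuple tnth (tuple_upd t o z) (lift o j) | j < n] =
             [tuple tnth t (lift o j) | j < n].
    by apply: eq_from_tnth => j; rewrite !tnth_mktuple eq_sym (negPf (neq_lift _ _)).
  by rewrite !E scalerDl scalerA.
rewrite !tnth_upd eq_sym (negPf io); rewrite eq_sym in io.
have [j jE _] := unlift_some io.
rewrite (@lin_at _ (fun t => [tuple tnth t (lift o j) | j < n])).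
  by rewrite scalerDr !scalerA mulrC.
move=> u; exists j, idfun => z; apply: eq_from_tnth => l.
by rewrite !tnth_mktuple jE (inj_eq (@lift_inj _ o)).
Qed.

Lemma merge_multilinear n (m : 'I_n) : multilinear (fun t => tens (merge m t)).
Proof.
move=> t i a x y; apply: (@lin_at _ (merge m)) => u.
have liftmax (l : 'I_n) : bump n l = l by rewrite /bump leqNgt ltn_ord.
have lift0 (l : 'I_n) : bump 0 l = l.+1 by [].
have i_le : (i <= n)%N by rewrite -ltnS ltn_ord.
case: (ltngtP i m) => im.
- have i_lt : (i < n)%N by apply: ltn_trans im _.
  exists (Ordinal i_lt), idfun => z; apply: eq_from_tnth => l.
  rewrite !tnth_mktuple -!val_eqE /= liftmax lift0.
  case: ltngtP => lm //=.
  + by rewrite !(gtn_eqF (ltn_trans im _)) // ltnS ltnW.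
  + by rewrite lm !(gtn_eqF im) (gtn_eqF (ltn_trans im _)).
- have [j_lt mj] : (i.-1 < n /\ m <= i.-1)%N.
    by case: (nat_of_ord i) im i_le => [|i'] //=; rewrite ltnS.
  have iE : i = i.-1.+1 :> nat by rewrite prednK // (leq_trans _ im).
  case: (ltngtP m i.-1) mj => // mj _.
    exists (Ordinal j_lt), idfun => z; apply: eq_from_tnth => l.
    rewrite !tnth_mktuple -!val_eqE /= liftmax lift0 iE eqSS.
    case: ltngtP => lm //=.
    + by rewrite (ltn_eqF (ltn_trans lm _)) ?(ltn_eqF (ltn_trans lm mj)) // ltnS ltnW.
    + by rewrite lm (ltn_eqF mj) (ltn_eqF (ltn_trans mj _)).
  exists m, (tnth u (lift ord_max m) \*o idfun) => z; apply: eq_from_tnth => l.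
  rewrite !tnth_mktuple -!val_eqE /= liftmax lift0 iE -mj eqSS.
  case: ltngtP => lm //=.
  + by rewrite (ltn_eqF (ltn_trans lm _)).
  + have -> : l = m by apply: val_inj.
    by rewrite (ltn_eqF (ltnSn _)).
- exists m, (tnth u (lift ord0 m) \o* idfun) => z; apply: eq_from_tnth => l.
  rewrite !tnth_mktuple -!val_eqE /= liftmax lift0 im.
  case: ltngtP => lm //=.
  + by rewrite (gtn_eqF (ltn_trans lm _)).
  + have -> : l = m by apply: val_inj.
    by rewrite (gtn_eqF (ltnSn _)).
Qed.

Lemma bd_tuple_multilinear n : multilinear (@bd_tuple n).
Proof.
apply: multilinearD; last exact/multilinearZ/drop_multilinear.
apply: multilinearD; first exact: drop_multilinear.
by apply: multilinear_sum => m; apply/multilinearZ/merge_multilinear.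
Qed.

(* [tpow A 0] is free of rank one, and the differential out of it is 0. *)
Definition bd n : {linear tpow A n -> tpow A n.-1} :=
  match n with
  | 0 => \0
  | n'.+1 => tpow_lift (@bd_tuple_multilinear n')
  end.

Definition HH n := homology (bd n.+1) (bd n).

Definition cobd n : {linear dual (tpow A n.-1) -> dual (tpow A n)} :=
  dual_map (bd n).

Definition HHco n := homology (cobd n) (cobd n.+1).

Lemma bd1 (z : tpow A 1) : bd 1 z = 0.
Proof.
apply: (tpow_lin_eq (f := bd 1) (g := \0)) => t /=.
rewrite tpow_liftE /bd_tuple big_ord0 addr0 expr1 scaleN1r.
have -> : ord_max = ord0 :> 'I_1 by apply: val_inj.
by rewrite (_ : drop_last t = drop_first t) ?subrr //; apply: eq_from_tnth => -[].
Qed.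

Lemma tens1_cycle (a : A) : tens (tup1 a) \in kerp (bd 1).
Proof. by rewrite inE bd1. Qed.

(* The class in [H_1] of [a], viewed as an element of [A = C_1]. *)
Definition HH1_class (a : A) : HH 1 :=
  cls _ (exist _ (tens (tup1 a)) (tens1_cycle a) : kerT (bd 1)).

Lemma tens1_linear : linear (fun a : A => tens (tup1 a)).
Proof.
move=> c a b.
have upd z : tup1 z = tuple_upd (tup1 0) ord0 z :> 1.-tuple A.
  by apply: eq_from_tnth => i; rewrite tnth_upd ord1.
by rewrite (upd (c *: a + b)) (upd a) (upd b); apply: tens_multilinear.
Qed.

Lemma HH1_class_linear : linear HH1_class.
Proof.
move=> c a b; apply: etrans (linearP _ c _ _); congr cls; apply: val_inj.
exact: tens1_linear.
Qed.

HB.instance Definition _ :=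
  GRing.isLinear.Build C A (HH 1) _ HH1_class HH1_class_linear.

Lemma bd3E (t : 3.-tuple A) :
  let a := tnth t ord0 in let b := tnth t (lift ord0 ord0) in
  let c := tnth t ord_max in
  bd 3 (tens t) = (eps a *: tens (tup2 b c) - tens (tup2 (a * b) c)
                  + tens (tup2 a (b * c)) - eps c *: tens (tup2 a b) : tpow A 2).
Proof.
move=> a b c; rewrite /= tpow_liftE /bd_tuple !big_ord_recr big_ord0 /= add0r.
have tE (u v : 2.-tuple A) : tnth u ord0 = tnth v ord0 ->
    tnth u ord_max = tnth v ord_max -> u = v.
  move=> u0 u1; apply: eq_from_tnth => -[[|[|//]] p].
    by rewrite (_ : Ordinal p = ord0) //; apply: val_inj.
  by rewrite (_ : Ordinal p = ord_max) //; apply: val_inj.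
have dE u v : u = v :> 'I_3 -> tnth t u = tnth t v by move->.
have -> : drop_first t = tup2 b c.
  by apply: tE; rewrite tnth_mktuple; apply/dE/val_inj.
have -> : drop_last t = tup2 a b.
  by apply: tE; rewrite tnth_mktuple; apply/dE/val_inj.
have -> : merge (widen_ord (leqnSn 1) ord_max) t = tup2 (a * b) c.
  apply: tE; rewrite tnth_mktuple /=; last exact/dE/val_inj.
  by congr (_ * _); apply/dE/val_inj.
have -> : merge ord_max t = tup2 a (b * c).
  apply: tE; rewrite tnth_mktuple /=; first exact/dE/val_inj.
  by congr (_ * _); apply/dE/val_inj.
rewrite expr1 sqrrN expr1n scaleN1r scale1r exprS sqrrN expr1n mulr1 scaleN1r.
by rewrite !addrA.
Qed.

End Hochschild.

Record star_op (C : numClosedFieldType) (A : algType C) := StarOp {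
  star_fun :> A -> A;
  starK : involutive star_fun;
  starD : {morph star_fun : a b / a + b};
  starZ : forall (c : C) a, star_fun (c *: a) = c^* *: star_fun a;
  starM : forall a b, star_fun (a * b) = star_fun b * star_fun a
}.

Record character (C : numClosedFieldType) (A : algType C) (star : star_op A) :=
  Character {
    char_fun :> {linear A -> C^o};
    charM : forall a b, char_fun (a * b) = char_fun a * char_fun b;
    char_star : forall a, char_fun (star a) = (char_fun a : C)^*;
    char_neq0 : exists a, char_fun a != 0
  }.

Section Augmentation.
Variables (C : numClosedFieldType) (A : algType C) (star : star_op A).
Variable eps : character star.

Lemma char1 : eps 1 = 1.
Proof.
have [a a0] := char_neq0 eps; apply: (mulfI a0).
by rewrite -charM !mulr1.
Qed.

Definition K1 := kerT eps.
HB.instance Definition _ := GRing.Lmodule.on K1.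

Lemma K1E (x : K1) : eps (val x) = 0. Proof. exact: kerTP. Qed.

Lemma K1mulr_subproof (x : K1) a : val x * a \in kerp eps.
Proof. by rewrite inE charM K1E mul0r. Qed.
Lemma K1mull_subproof a (x : K1) : a * val x \in kerp eps.
Proof. by rewrite inE charM K1E mulr0. Qed.
Lemma K1center_subproof a : a - eps a *: 1 \in kerp eps.
Proof. by rewrite inE linearB linearZ /= char1 [_ *: _]mulr1 subrr. Qed.

Definition K1mulr (x : K1) (a : A) : K1 := exist _ (val x * a) (K1mulr_subproof x a).
Definition K1mull (a : A) (x : K1) : K1 := exist _ (a * val x) (K1mull_subproof a x).
Definition K1center (a : A) : K1 := exist _ (a - eps a *: 1) (K1center_subproof a).

Lemma K1center_linear : linear K1center.
Proof.
move=> c a b; apply: val_inj; rewrite /= linearP scalerDl scalerBr scalerA.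
by rewrite opprD addrACA.
Qed.

(* Relations presenting the tensor product over [A] of the right module [K1]
   and the left module [K1] as a quotient of the free space on pairs. *)
Variant tensorA_rel : {malg C[(K1 * K1)%type]} -> Prop :=
| TensorALinl c x x' y : tensorA_rel
    (<< (c *: x + x', y) >> - (c *: << (x, y) >> + << (x', y) >>))
| TensorALinr c x y y' : tensorA_rel
    (<< (x, c *: y + y') >> - (c *: << (x, y) >> + << (x, y') >>))
| TensorABalanced x a y : tensorA_rel
    (<< (K1mulr x a, y) >> - << (x, K1mull a y) >>).

Definition K1tensor := lquot tensorA_rel.
HB.instance Definition _ := GRing.Lmodule.on K1tensor.

Definition tensA : K1 -> K1 -> K1tensor :=
  locked_with lock_key (fun x y => cls tensorA_rel << (x, y) >>).

Lemma tensA_linl y : linear (tensA^~ y).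
Proof.
move=> c x x'; rewrite /tensA unlock; apply: cls_lin; exact: TensorALinl.
Qed.
Lemma tensA_linr x : linear (tensA x).
Proof.
move=> c y y'; rewrite /tensA unlock; apply: cls_lin; exact: TensorALinr.
Qed.
Lemma tensA_balanced x a y : tensA (K1mulr x a) y = tensA x (K1mull a y).
Proof. by rewrite /tensA unlock; apply/cls_eq/mem_spanp; exact: TensorABalanced. Qed.

HB.instance Definition _ x :=
  GRing.isLinear.Build C K1 K1tensor _ (tensA x) (tensA_linr x).

Section Lift.
Variables (W : lmodType C) (f : K1 -> K1 -> W).

Definition balanced_bilinear : Prop :=
  [/\ forall y, linear (f^~ y), forall x, linear (f x)
    & forall x a y, f (K1mulr x a) y = f x (K1mull a y)].

Lemma tensorA_lift_rel : balanced_bilinear ->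
  forall g, tensorA_rel g -> free_lift (fun xy => f xy.1 xy.2) g = 0.
Proof.
move=> [fl fr fb] _ [c x x' y|c x y y'|x a y].
- by rewrite free_lift_lin /= fl subrr.
- by rewrite free_lift_lin /= fr subrr.
- by rewrite free_liftB /= fb subrr.
Qed.

Definition tensorA_lift (fB : balanced_bilinear) : K1tensor -> W :=
  lquot_lift (tensorA_lift_rel fB).

Variable fB : balanced_bilinear.

HB.instance Definition _ := GRing.Linear.on (tensorA_lift fB).

Lemma tensorA_liftE x y : tensorA_lift fB (tensA x y) = f x y.
Proof. by rewrite /tensorA_lift /tensA unlock lquot_liftE /= free_liftE. Qed.
End Lift.

Lemma K1mul_balanced : balanced_bilinear (fun x y => K1mulr x (val y)).
Proof.
split=> [y c x x'|x c y y'|x a y]; apply: val_inj => /=.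
- by rewrite mulrDl scalerAl.
- by rewrite mulrDr scalerAr.
- by rewrite mulrA.
Qed.

Definition mu : K1tensor -> K1 := tensorA_lift K1mul_balanced.
HB.instance Definition _ := GRing.Linear.on mu.

Lemma muE x y : val (mu (tensA x y)) = val x * val y.
Proof. by rewrite /mu tensorA_liftE. Qed.

Definition p_tuple (t : 2.-tuple A) : K1tensor :=
  tensA (K1center (tnth t ord0)) (K1center (tnth t ord_max)).

Lemma p_tuple_multilinear : multilinear p_tuple.
Proof.
move=> t i a x y; rewrite /p_tuple !tnth_upd.
have [->|i0] := eqVneq i ord0.
  by rewrite /= K1center_linear tensA_linl.
have -> : i = ord_max.
  by apply: val_inj; case: i i0 => -[|[|]].
by rewrite eqxx /= K1center_linear tensA_linr.
Qed.

Definition lifts (phi : K1tensor -> C^o) (psi : A -> C^o) : Prop :=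
  psi 1 = 0 /\ forall x y : K1, psi (val x * val y) = phi (tensA x y).

Definition p_chain : tpow A 2 -> K1tensor := tpow_lift p_tuple_multilinear.
HB.instance Definition _ := GRing.Linear.on p_chain.

Lemma p_chainE a b : p_chain (tens (tup2 a b)) = tensA (K1center a) (K1center b).
Proof. by rewrite /p_chain tpow_liftE. Qed.

Lemma K1centerMr a b :
  K1center (a * b) = eps a *: K1center b + K1mulr (K1center a) b.
Proof.
apply: val_inj => /=; rewrite charM mulrBl -scalerAl mul1r scalerBr scalerA.
by rewrite [RHS]addrC subrKA.
Qed.

Lemma K1centerMl a b :
  K1center (a * b) = eps b *: K1center a + K1mull a (K1center b).
Proof.
apply: val_inj => /=; rewrite charM mulrBr -scalerAr mulr1 scalerBr scalerA.
by rewrite [eps a * _]mulrC [RHS]addrC subrKA.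
Qed.

Let lin4 (U W : lmodType C) (f : {linear U -> W}) a x y z b w :
  f (a *: x - y + z - b *: w) = a *: f x - f y + f z - b *: f w.
Proof. by rewrite linearB linearD linearB !linearZ. Qed.

Let cancel4 (W : lmodType C) (x y z : W) : x - (x + y) + (z + y) - z = 0.
Proof. by rewrite opprD addNKr addrCA addNr addr0 subrr. Qed.

Let p_chain4 a x y z b w :
  p_chain (a *: x - y + z - b *: w) =
  a *: p_chain x - p_chain y + p_chain z - b *: p_chain w.
Proof. exact: lin4. Qed.

Lemma p_chain_bd u : p_chain (bd eps 3 u) = 0.
Proof.
apply: (tpow_lin_eq (f := p_chain \o bd eps 3) (g := \0)) => t.
change (p_chain (bd eps 3 (tens t)) = 0); rewrite bd3E.
move: (tnth t _) (tnth t _) (tnth t _) => a b c.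
rewrite p_chain4.
rewrite !p_chainE.
rewrite K1centerMr.
rewrite tensA_linl.
rewrite [K1center (b * _)]K1centerMl.
rewrite tensA_linr.
rewrite tensA_balanced.
exact: cancel4.
Qed.

Definition p_cycle : {linear kerT (bd eps 2) -> K1tensor} := p_chain \o val.

Lemma p_rel z : (exists u, bd eps 3 u = val z) -> p_cycle z = 0.
Proof. by move=> [u /= <-]; exact: p_chain_bd. Qed.

Definition hoch_p : HH eps 2 -> K1tensor := lquot_lift p_rel.
HB.instance Definition _ := GRing.Linear.on hoch_p.

End Augmentation.

Section Schurmann.
Variables (C : numClosedFieldType) (A : algType C) (star : star_op A).
Variable eps : character star.

(* A pre-Hilbert space is an [lmodType C] with a form in [{dot D for Num.conj}].
   Such forms are linear in the first argument; [inner] is linear in the second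
   one. *)
Definition inner (D : lmodType C) (form : {dot D for Num.conj}) (x y : D) : C :=
  form y x.

Definition is_adjoint (D : lmodType C) (form : {dot D for Num.conj})
    (T S : {linear D -> D}) : Prop :=
  forall x y, inner form (S x) y = inner form x (T y).

(* Unital *-homomorphisms from [A] to the adjointable operators on [D]: by
   positive definiteness an adjoint is unique, so [rep_star] says both that
   each operator is adjointable and that its adjoint is the image of [star a]. *)
Record star_rep (D : lmodType C) (form : {dot D for Num.conj}) := StarRep {
  rep_fun :> A -> {linear D -> D};
  rep_linear : forall c a b x,
    rep_fun (c *: a + b) x = c *: rep_fun a x + rep_fun b x;
  rep1 : forall x, rep_fun 1 x = x;
  repM : forall a b x, rep_fun (a * b) x = rep_fun a (rep_fun b x);
  rep_star : forall a, is_adjoint form (rep_fun a) (rep_fun (star a))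
}.

Record cocycle (D : lmodType C) (form : {dot D for Num.conj}) (pi : star_rep form) :=
  Cocycle {
    coc_fun :> {linear A -> D};
    cocM : forall a b, coc_fun (a * b) = pi a (coc_fun b) + eps b *: coc_fun a
  }.

Section Cocycle.
Variables (D : lmodType C) (form : {dot D for Num.conj}) (pi : star_rep form).
Variable eta : cocycle pi.

Definition calK_form (x y : K1 eps) : C^o :=
  inner form (eta (star (val x))) (eta (val y)).

Lemma calK_balanced : balanced_bilinear calK_form.
Proof.
split=> [y c x x'|x c y y'|x a y]; rewrite /calK_form /inner.
- have -> : val (c *: x + x') = c *: val x + val x' by [].
  rewrite starD starZ linearP linearDr linearZr_LR /=.
  by rewrite conjCK.
- have -> : val (c *: y + y') = c *: val y + val y' by [].
  by rewrite linearP linearDl linearZl_LR.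
have -> : val (K1mulr x a) = val x * a by [].
have -> : val (K1mull a y) = a * val y by [].
have sx0 : eps (star (val x)) = 0 by rewrite char_star K1E conjC0.
have y0 : eps (val y) = 0 by exact: K1E.
rewrite starM !cocM sx0 y0 !scale0r !addr0.
exact: (rep_star pi a).
Qed.

Definition calK : K1tensor eps -> C^o := tensorA_lift calK_balanced.
HB.instance Definition _ := GRing.Linear.on calK.

Lemma calKE x y :
  calK (tensA x y) = inner form (eta (star (val x))) (eta (val y)).
Proof. exact: tensorA_liftE. Qed.

Definition hermitian_functional (psi : {linear A -> C^o}) : Prop :=
  forall a, psi (star a) = (psi a : C)^*.

Definition schurmann_triple (psi : {linear A -> C^o}) : Prop :=
  hermitian_functional psi /\
  forall a b, eps a * psi b - psi (a * b) + psi a * eps b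
              = - inner form (eta (star a)) (eta b).

Definition admits_generating_functional : Prop :=
  exists psi : {linear A -> C^o}, schurmann_triple psi.

End Cocycle.

Definition property_AC : Prop :=
  forall (D : lmodType C) (form : {dot D for Num.conj}) (pi : star_rep form)
         (eta : cocycle pi),
    exists psi : {linear A -> C^o}, schurmann_triple eta psi.

End Schurmann.

(* Main.v *)
Require Import Defs.
From HB Require Import structures.
From mathcomp Require Import all_boot all_order all_algebra.
From mathcomp Require Import boolp classical_sets reals complex monalg.
From mathcomp Require Import ring.
Import GRing.Theory Num.Theory.
Local Open Scope ring_scope.

Set Implicit Arguments.
Unset Strict Implicit.
Unset Printing Implicit Defensive.

(** Write [a' = a - eps a 1] for the centering of [a], which lies in [K1]. The
boundary of [a] tensor [b] is [eps a b - a b + eps b a], and this equals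
[eps a eps b 1 - a' b'] ([coboundary_center]). Centering it gives [- a' b'], so
the composition of [mu] with the chain map underlying [hoch_p] is minus the
centered boundary ([mu_p_chain]). Hence 2-cycles go to the kernel of [mu].
Conversely every [t] in the tensor product lifts to a 2-chain with boundary
[- mu t] ([p_chain_surj]), which is a cycle when [mu t = 0]. So the range of
[hoch_p] is the kernel of [mu] ([range_hoch_p]).

A functional [phi] has the form [psi \o mu] if and only if it vanishes on the
kernel of [mu]: a functional on the image of [mu] extends to all of [K1], and
centering extends it to [A] with value 0 at [1] ([lifts_exists]). Two solutions
differ by a functional on [A] that vanishes at [1] and on products of elements
of [K1]; by the formula for the boundary, these are the functionals that vanish
on boundaries, which are the functionals on the first homology
([lifts_unique]).

The cochain complex is the dual of the chain complex, and over a field a pair of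
maps is exact if and only if the dual pair is ([homology_dual]); this gives the
equivalence of the vanishing of second homology and cohomology. It rests, as
does [lifts_exists], on the extension of functionals from subspaces of arbitrary
vector spaces, which follows from Zorn's lemma ([separating_functional],
[factor_functional]).

A generating functional of a cocycle is a hermitian lift of [calK eta]. A lift
can be made hermitian by averaging it with its adjoint
([lifts_calK_hermitian]), so it exists if and only if [calK eta] vanishes on the
kernel of [mu] ([admits_calK]). If the second cohomology is zero, so are the
second homology and its image, the kernel of [mu], and every cocycle has a
generating functional. *)

(** * Linear functionals on spaces of arbitrary dimension *)

Section Extension.
Variables (C : numClosedFieldType) (V : lmodType C).
Implicit Types (G : V -> Prop) (N : set V) (e v : V).

Lemma in_spanS G (G' : V -> Prop) v :
  (forall w, G w -> G' w) -> in_span G v -> in_span G' v.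
Proof.
move=> GG'; elim=> [|c u w Gu _ IH]; first exact: in_span0.
by apply: in_spanD => //; exact: GG'.
Qed.

Lemma in_span_add1 G x v :
  in_span (fun w => G w \/ w = x) v -> exists c : C, v - c *: x \in spanp G.
Proof.
elim=> [|c u w [Gu|->] _ [d IH]].
- by exists 0; rewrite scale0r subr0 rpred0.
- by exists d; rewrite -addrA rpredD // rpredZ // mem_spanp.
- by exists (c + d); rewrite scalerDl opprD addrACA subrr add0r.
Qed.

(** This is what makes Zorn's lemma applicable to spans. The alternative on the
left covers the empty chain. *)
Lemma in_span_bigcup G0 (F : set (set V)) v : total_on F subset ->
  in_span (fun w => (\bigcup_(X in F) X)%classic w \/ G0 w) v ->
  in_span G0 v \/ exists2 X, F X & in_span (fun w => X w \/ G0 w) v.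
Proof.
move=> Ftot; elim=> [|c u w Gu _ IH]; first by left; exact: in_span0.
case: Gu IH => [[X FX Xu]|G0u] [sw|[Y FY sw]].
- right; exists X => //; apply: in_spanD; first by left.
  by apply: in_spanS sw; right.
- have [XY|YX] := Ftot _ _ FX FY.
    by right; exists Y => //; apply: in_spanD => //; left; exact: XY.
  right; exists X => //; apply: in_spanD; first by left.
  by apply: in_spanS sw => z [/YX|]; [left|right].
- by left; apply: in_spanD.
- by right; exists Y => //; apply: in_spanD => //; right.
Qed.

(** Zorn's lemma applied to the sets whose span together with [G0] avoids [e].
By maximality, adding a vector [v] outside the span puts [e] into it, and the
coefficient of [v] there is invertible; so the span is a hyperplane that is a
complement of the line through [e]. *)
Lemma maximal_avoiding G0 e : e \notin spanp G0 ->
  exists G, [/\ forall v, G0 v -> G v, e \notin spanp G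
    & forall v, exists c : C, v - c *: e \in spanp G].
Proof.
move=> eG0; pose G N v := N v \/ G0 v.
pose P : set (set V) := fun N => e \notin spanp (G N).
have [F FP Ftot|N [PN Nmax]] := @Zorn_bigcup V P.
  apply/negP => /spanpP /(in_span_bigcup Ftot)[s|[X FX s]].
    by move/negP: eG0; apply; apply/spanpP.
  by move/negP: (FP _ FX); apply; apply/spanpP.
exists (G N); split=> // [v G0v|x]; first by right.
have [xN|xN] := boolP (x \in spanp (G N)).
  by exists 0; rewrite scale0r subr0.
pose Nx : set V := fun w => N w \/ w = x.
have /Nmax PNx : (N `<` Nx)%classic.
  split=> [w Nw|/(_ x (or_intror erefl)) Nx']; first by left.
  by move/negP: xN; apply; apply/mem_spanp; left.
have /spanpP : e \in spanp (G Nx) by apply: contrapT => /negP.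
move=> eNx; have [|c ec] := @in_span_add1 (G N) x e.
  by apply: in_spanS eNx => w [[]|]; rewrite /G; tauto.
have c0 : c != 0 by apply: contraNneq PN => c0; rewrite c0 scale0r subr0 in ec.
exists c^-1; rewrite -rpredN opprB.
suff -> : c^-1 *: e - x = c^-1 *: (e - c *: x) by rewrite rpredZ.
by rewrite scalerBr scalerA mulVf // scale1r.
Qed.

(** The functional is the coordinate along [e] with respect to the hyperplane
given by [maximal_avoiding]. *)
Lemma separating_functional G0 e : e \notin spanp G0 ->
  exists h : {linear V -> C^o}, h e = 1 /\ forall v, G0 v -> h v = 0.
Proof.
move=> /maximal_avoiding[G [G0G eG /choice[h hP]]].
have huniq v c : v - c *: e \in spanp G -> h v = c.
  move=> vc; apply/eqP; rewrite -subr_eq0; apply: contraNT eG => d0.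
  have := rpredB vc (hP v).
  rewrite opprB addrC addrA subrK -scalerBl => /(rpredZ (h v - c)^-1).
  by rewrite scalerA mulVf // scale1r.
have hlin : linear (h : V -> C^o).
  move=> a u v; apply: huniq.
  rewrite scalerDl opprD addrACA -scalerA -scalerBr.
  by rewrite rpredD // rpredZ.
pose hL : {linear V -> C^o} :=
  HB.pack (h : V -> C^o) (GRing.isLinear.Build C V C^o _ h hlin).
exists hL; split=> [|v Gv]; apply: huniq.
  by rewrite scale1r subrr rpred0.
by rewrite scale0r subr0; apply/mem_spanp/G0G.
Qed.

End Extension.

(** If [g] is not zero, choose [u0] with [g u0 != 0]. Then [f u0] does not lie in
the image under [f] of the kernel of [g]; a functional that separates it from
this image is, up to the factor [g u0], the wanted extension. *)
Lemma factor_functional (C : numClosedFieldType) (U V : lmodType C)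
    (f : {linear U -> V}) (g : {linear U -> C^o}) :
  (forall u, f u = 0 -> g u = 0) ->
  exists h : {linear V -> C^o}, forall u, h (f u) = g u.
Proof.
move=> fg; have [[u0 gu0]|g0] := pselect (exists u, g u != 0); last first.
  exists \0 => u /=; apply/esym; apply: contrapT => /eqP gu.
  by apply: g0; exists u.
pose G v := exists2 k, g k = 0 & f k = v.
have spanG v : in_span G v -> G v.
  elim=> [|c _ _ [k gk <-] _ [l gl <-]]; first by exists 0; rewrite linear0.
  by exists (c *: k + l); rewrite linearP ?gk ?gl ?scaler0 ?addr0.
have [|h [he hG]] := @separating_functional C V G (f u0).
  apply/negP => /spanpP/spanG[k gk fk].
  by move: gu0; rewrite -[u0](subrK k) linearD fg ?gk ?addr0 ?eqxx // linearB fk subrr.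
have gl : linear (fun v => g u0 *: h v : C^o).
  by move=> a u v; rewrite linearP scalerDr !scalerA mulrC.
pose hL : {linear V -> C^o} := HB.pack (fun v => g u0 *: h v : C^o)
  (GRing.isLinear.Build C V C^o _ (fun v => g u0 *: h v : C^o) gl).
exists hL => u /=.
pose c : C := (g u0)^-1 * g u.
have gk : g (u - c *: u0) = 0.
  by rewrite linearB linearZ /= [c *: _]mulrC [g u0 * _]mulrA mulfV // mul1r subrr.
have := hG (f (u - c *: u0)) (ex_intro2 _ _ _ gk erefl).
rewrite linearB linearZ linearB linearZ /= he => /eqP; rewrite subr_eq0 => /eqP ->.
by rewrite [c *: 1]mulr1 [g u0 *: _]mulrA mulfV // mul1r.
Qed.

(** * Homology and duality *)

Section Homology.
Variables (C : numClosedFieldType) (U V W : lmodType C).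
Variables (f : {linear U -> V}) (g : {linear V -> W}).

Lemma homology_cls0 (z : kerT g) :
  (cls _ z = 0 :> homology f g) <-> exists u, f u = val z.
Proof.
rewrite -[0](linear0 (cls _)); split=> [/cls_eq|zf]; last first.
  by apply/cls_eq/mem_spanp; rewrite subr0.
rewrite subr0 => /spanpP; elim=> [|c x y [u fu] _ [v fv]].
  by exists 0; rewrite linear0.
by exists (c *: u + v); rewrite linearP fu fv.
Qed.

Lemma homology_eq0 :
  (forall x : homology f g, x = 0) <-> (forall v, g v = 0 -> exists u, f u = v).
Proof.
split=> [H v gv|H x].
  have vP : v \in kerp g by apply/eqP.
  by have /homology_cls0 := H (cls _ (exist _ v vP : kerT g)).
by rewrite -[x]cls_repr; apply/homology_cls0/H/kerTP.
Qed.

Lemma homology_lift (X : lmodType C) (h : {linear V -> X}) :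
  (forall u, h (f u) = 0) ->
  exists hb : {linear homology f g -> X}, forall z : kerT g, hb (cls _ z) = h (val z).
Proof.
move=> hf; pose hv : {linear kerT g -> X} := h \o val.
have hvG z : (exists u, f u = val z) -> hv z = 0.
  by move=> [u uz]; rewrite /hv /= -uz hf.
by exists (lquot_lift hvG) => z; exact: lquot_liftE.
Qed.

End Homology.

Section Duality.
Variables (C : numClosedFieldType) (U V W : lmodType C).
Variables (f : {linear U -> V}) (g : {linear V -> W}).

Lemma dual_eqP (X : lmodType C) (p q : dual X) :
  p = q <-> dual_fun p =1 dual_fun q.
Proof. by split=> [->//|pq]; apply: val_inj; apply/funext. Qed.

Definition dual_of (X : lmodType C) (h : {linear X -> C^o}) : dual X.
Proof. by exists h; apply/asboolP/linearP. Defined.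

(** Exactness of a pair of maps is equivalent to exactness of the dual pair. A
dual cycle vanishes on the image of [f], which is the kernel of [g], so it
factors through [g]. Conversely, if some [v] in the kernel of [g] is not in the
image of [f], a functional that separates [v] from this image is a dual cycle;
were it a dual boundary, it would vanish at [v]. *)
Lemma homology_dual : (forall x : homology f g, x = 0) <->
  (forall x : homology (dual_map g) (dual_map f), x = 0).
Proof.
rewrite !homology_eq0; split=> H; last first.
  move=> v gv; apply: contrapT => nfv.
  have [|h [hv hf]] := @separating_functional C V (fun w => exists u, f u = w) v.
    apply/negP => /spanpP sv; apply: nfv.
    elim: sv => [|c _ _ [u <-] _ [u' <-]]; first by exists 0; rewrite linear0.
    by exists (c *: u + u'); rewrite linearP.
  have [|chi /dual_eqP chiE] := H (dual_of h).
    by apply/dual_eqP => u /=; apply: hf; exists u.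
  have : dual_fun chi (g v) = h v by exact: chiE.
  by rewrite gv linear0 hv => /eqP; rewrite eq_sym oner_eq0.
move=> phi /dual_eqP phif; have [|h hE] := @factor_functional C V W g (dual_fun phi).
  by move=> v /H[u <-]; exact: phif.
by exists (dual_of h); apply/dual_eqP.
Qed.

End Duality.

(** * Chains of degree one and two *)

Section LowDegree.
Variables (C : numClosedFieldType) (A : algType C).

Lemma tens1_lift_multilinear (W : lmodType C) (f : {linear A -> W}) :
  multilinear (fun t : 1.-tuple A => f (tnth t ord0)).
Proof. by move=> t i a x y; rewrite ord1 !tnth_upd eqxx linearP. Qed.

Definition tpow1_lift (W : lmodType C) (f : {linear A -> W}) :
  {linear tpow A 1 -> W} := tpow_lift (tens1_lift_multilinear f).

Lemma tpow1_liftE (W : lmodType C) (f : {linear A -> W}) a :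
  tpow1_lift f (tens (tup1 a)) = f a.
Proof. by rewrite /= tpow_liftE. Qed.

Lemma tpow2_lin_eq (W : lmodType C) (f g : {linear tpow A 2 -> W}) :
  (forall a b, f (tens (tup2 a b)) = g (tens (tup2 a b))) -> f =1 g.
Proof.
move=> fg; apply: tpow_lin_eq => t.
have -> : t = tup2 (tnth t ord0) (tnth t ord_max).
  by apply: eq_from_tnth => -[[|[|//]] p]; rewrite [RHS](tnth_nth (tnth t ord0)) /=;
     congr tnth; apply: val_inj.
exact: fg.
Qed.

Lemma bd2E (eps : {linear A -> C^o}) a b :
  bd eps 2 (tens (tup2 a b)) =
  eps a *: tens (tup1 b) - tens (tup1 (a * b)) + eps b *: tens (tup1 a)
    :> tpow A 1.
Proof.
rewrite /= tpow_liftE /bd_tuple big_ord_recr big_ord0 /= add0r.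
rewrite expr1 sqrrN expr1n scaleN1r scale1r.
have tE (u v : 1.-tuple A) : tnth u ord0 = tnth v ord0 -> u = v.
  by move=> uv; apply: eq_from_tnth => i; rewrite ord1.
have -> : drop_first (tup2 a b) = tup1 b by apply: tE; rewrite tnth_mktuple.
have -> : drop_last (tup2 a b) = tup1 a by apply: tE; rewrite tnth_mktuple.
have -> : Defs.merge ord_max (tup2 a b) = tup1 (a * b).
  by apply: tE; rewrite tnth_mktuple.
by [].
Qed.

Definition tens1 (a : A) : tpow A 1 := tens (tup1 a).

HB.instance Definition _ :=
  GRing.isLinear.Build C A (tpow A 1) _ tens1 (@tens1_linear C A).

Lemma tens1E a : tens1 a = tens (tup1 a). Proof. by []. Qed.

End LowDegree.

(** * The multiplication map and the second homology *)

Section Sequence.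
Variables (C : numClosedFieldType) (A : algType C) (star : star_op A).
Variable eps : character star.

HB.instance Definition _ :=
  GRing.isLinear.Build C A (K1 eps) _ (K1center eps) (K1center_linear eps).

Lemma K1center_id (x : K1 eps) : K1center eps (val x) = x.
Proof. by apply: val_inj; rewrite /= K1E scale0r subr0. Qed.

Lemma K1center1 : K1center eps 1 = 0.
Proof. by apply: val_inj; rewrite /= char1 scale1r subrr. Qed.

Lemma K1tensor_lin_eq (W : lmodType C) (f g : {linear K1tensor eps -> W}) :
  (forall x y, f (tensA x y) = g (tensA x y)) -> f =1 g.
Proof.
move=> fg t; rewrite -[t]cls_repr; rewrite /tensA unlock in fg.
by apply: (@free_lin_eq _ _ _ (f \o cls _) (g \o cls _)) => -[x y]; exact: fg.
Qed.

(** This links the Hochschild complex with the multiplication of [K1]: the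
left-hand side corresponds to the boundary of [a] tensor [b] under the
identification of [tpow A 1] with [A]. *)
Lemma coboundary_center a b :
  eps a *: b - a * b + eps b *: a =
  (eps a * eps b) *: 1 - val (K1center eps a) * val (K1center eps b).
Proof.
rewrite /= mulrBl !mulrBr -!scalerAl !mul1r -!scalerAr mulr1.
by rewrite scalerA !opprB addrA [_%:A + _]addrC subrK addrA addrAC.
Qed.

Lemma coboundary_functional (psi : {linear A -> C^o}) a b : psi 1 = 0 ->
  eps a * psi b - psi (a * b) + psi a * eps b =
  - psi (val (K1center eps a) * val (K1center eps b)).
Proof.
move=> psi1; have := congr1 psi (coboundary_center a b).
by rewrite linearD !linearB !linearZ psi1 /= scaler0 sub0r [psi a * _]mulrC => <-.
Qed.

(** On [tens (tup2 a b)] this is [coboundary_center] followed by [K1center],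
which kills [1]. In particular [p_chain] maps cycles to the kernel of [mu]. *)
Lemma mu_p_chain z :
  mu (p_chain eps z) = - tpow1_lift (K1center eps) (bd eps 2 z).
Proof.
pose f : {linear tpow A 2 -> K1 eps} := @mu _ _ _ eps \o @p_chain _ _ _ eps.
pose g : {linear tpow A 2 -> K1 eps} :=
  (\- (tpow1_lift (K1center eps) \o bd eps 2)).
apply: (@tpow2_lin_eq _ _ _ f g) => a b.
change (mu (p_chain eps (tens (tup2 a b))) =
  - tpow1_lift (K1center eps) (bd eps 2 (tens (tup2 a b)))).
have -> : tpow1_lift (K1center eps) (bd eps 2 (tens (tup2 a b))) =
          K1center eps (eps a *: b - a * b + eps b *: a).
  by rewrite bd2E linearD linearB !linearZ !tpow1_liftE linearD linearB !linearZ.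
have KE c u v : K1center eps (c *: u - v) = c *: K1center eps u - K1center eps v.
  by rewrite linearB linearZ.
by rewrite coboundary_center KE K1center1 scaler0 sub0r opprK p_chainE -muE K1center_id.
Qed.

(** A tensor of [x] and [y] in [K1] lifts to the chain of the same two elements,
whose boundary is minus their product, as both are annihilated by [eps]. This
lift need not respect the balancing relation, so it is defined on the free
module of which [K1tensor] is a quotient. *)
Lemma p_chain_surj t : exists z,
  p_chain eps z = t /\ bd eps 2 z = - tens (tup1 (val (mu t))).
Proof.
pose s := free_lift (fun xy : K1 eps * K1 eps => tens (tup2 (val xy.1) (val xy.2))).
exists (s (repr t)); split; rewrite -{2}[t]cls_repr; move: (repr t) => {t} g.
  pose f1 : {linear {malg C[(K1 eps * K1 eps)%type]} -> K1tensor eps} :=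
    @p_chain _ _ _ eps \o s.
  apply: (@free_lin_eq _ _ _ f1 (cls _)) => -[x y].
  change (p_chain eps (s << (x, y) >>) = cls (@tensorA_rel _ _ _ eps) << (x, y) >>).
  by rewrite /s free_liftE p_chainE !K1center_id /tensA unlock.
pose f1 : {linear {malg C[(K1 eps * K1 eps)%type]} -> tpow A 1} := bd eps 2 \o s.
pose f2 : {linear {malg C[(K1 eps * K1 eps)%type]} -> tpow A 1} :=
  (\- (@tens1 C A \o (val \o (@mu _ _ _ eps \o cls _)))).
apply: (@free_lin_eq _ _ _ f1 f2) => -[x y].
change (bd eps 2 (s << (x, y) >>) =
   - tens (tup1 (val (mu (cls (@tensorA_rel _ _ _ eps) << (x, y) >>))))).
rewrite /s free_liftE bd2E !K1E !scale0r add0r addr0; congr (- tens (tup1 _)).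
by rewrite -muE /tensA unlock.
Qed.

(** If [mu t = 0], the lift of [t] given by [p_chain_surj] is a cycle. *)
Lemma range_hoch_p (t : K1tensor eps) :
  (exists z : HH eps 2, hoch_p z = t) <-> mu t = 0.
Proof.
split=> [[z <-]|mut].
  rewrite -[z]cls_repr; move: (repr z) => {}z.
  rewrite /hoch_p lquot_liftE.
  change (mu (p_chain eps (val z)) = 0).
  by rewrite mu_p_chain kerTP linear0 oppr0.
have [z [zt bz]] := p_chain_surj t.
have zP : z \in kerp (bd eps 2).
  by apply/eqP; rewrite bz mut -tens1E linear0 oppr0.
exists (cls _ (exist _ z zP : kerT (bd eps 2))).
by rewrite /hoch_p lquot_liftE.
Qed.

Lemma lifts_mu (phi : {linear K1tensor eps -> C^o}) (psi : {linear A -> C^o}) t :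
  (forall x y, psi (val x * val y) = phi (tensA x y)) -> phi t = psi (val (mu t)).
Proof.
move=> phipsi.
pose g : {linear K1tensor eps -> C^o} := psi \o (val \o @mu _ _ _ eps).
apply: (@K1tensor_lin_eq _ phi g) => x y.
by rewrite -phipsi -muE.
Qed.

(** A functional that vanishes on the kernel of [mu] extends from the image of
[mu] to [K1] by [factor_functional], and then to [A] by centering. *)
Lemma lifts_exists (phi : {linear K1tensor eps -> C^o}) :
  (exists psi : {linear A -> C^o}, lifts phi psi) <->
  (forall t, mu t = 0 -> phi t = 0).
Proof.
split=> [[psi [_ phipsi]] t mut|].
  by rewrite (lifts_mu _ phipsi) mut linear0.
move=> phimu.
have [h hE] := @factor_functional _ _ _ (@mu _ _ _ eps) phi phimu.
pose psi : {linear A -> C^o} := h \o K1center eps.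
exists psi; split=> [|x y].
  by rewrite /psi /= K1center1 linear0.
by rewrite /psi /= -hE -muE K1center_id.
Qed.

(** The differences of two solutions are the functionals that vanish at [1] and
on products of elements of [K1]; by [coboundary_functional] these are the
functionals that vanish on boundaries of degree one. *)
Lemma lifts_unique (phi : {linear K1tensor eps -> C^o})
    (psi psi' : {linear A -> C^o}) : lifts phi psi ->
  (lifts phi psi' <-> exists h : {linear HH eps 1 -> C^o},
     forall a : A, psi' a = psi a + h (HH1_class eps a)).
Proof.
move=> [psi1 phipsi]; split=> [[psi'1 phipsi']|[h hE]].
  pose d : {linear A -> C^o} := psi' \- psi.
  have dE a : d a = psi' a - psi a by [].
  have d1 : d 1 = 0 by rewrite dE psi1 psi'1 subr0.
  have dK a b : d (val (K1center eps a) * val (K1center eps b)) = 0.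
    by rewrite dE phipsi phipsi' subrr.
  have db : forall u, tpow1_lift d (bd eps 2 u) = 0.
    pose g : {linear tpow A 2 -> C^o} := tpow1_lift d \o bd eps 2.
    apply: (@tpow2_lin_eq _ _ _ g \0) => a b.
    change (tpow1_lift d (bd eps 2 (tens (tup2 a b))) = 0).
    rewrite bd2E linearD linearB !linearZ !tpow1_liftE.
    have := coboundary_functional a b d1; rewrite dK oppr0 => <-.
    by rewrite [d a * _]mulrC.
  have [h hE] := @homology_lift _ _ _ _ (bd eps 2) (bd eps 1) _ (tpow1_lift d) db.
  exists h => a.
  have -> : h (HH1_class eps a) = d a by apply: etrans (hE _) _; exact: tpow1_liftE.
  by rewrite dE addrC subrK.
(* The unit is the boundary of the tensor square of [1], and a product of two
   elements of [K1] is minus the boundary of their tensor product. *)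
have c0 a u : bd eps 2 u = tens (tup1 a) -> HH1_class eps a = 0.
  by move=> ua; apply/homology_cls0; exists u.
split=> [|x y].
  rewrite hE psi1 (c0 1 (tens (tup2 1 1))) ?linear0 ?addr0 //.
  by rewrite bd2E char1 !scale1r mulr1 subrr add0r.
rewrite hE phipsi (c0 _ (- tens (tup2 (val x) (val y)))) ?linear0 ?addr0 //.
by rewrite linearN bd2E !K1E !scale0r add0r addr0 opprK.
Qed.

End Sequence.

(** * Generating functionals *)

Section Schurmann.
Variables (C : numClosedFieldType) (A : algType C) (star : star_op A).
Variable eps : character star.
Variables (D : lmodType C) (form : {dot D for Num.conj}).
Variables (pi : star_rep star form) (eta : cocycle eps pi).

Lemma star1 : star 1 = 1.
Proof.
by have := starM star 1 (star 1); rewrite mul1r starK mul1r => /esym.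
Qed.

Lemma inner_conj (x y : D) : (inner form x y)^* = inner form y x.
Proof. by rewrite /inner [RHS](hermC form) expr0 mul1r. Qed.

Lemma coc1 : eta 1 = 0.
Proof.
have := cocM eta 1 1; rewrite mul1r rep1 char1 scale1r => /eqP.
by rewrite -subr_eq0 opprD addNKr oppr_eq0 => /eqP.
Qed.

Lemma coc_center a : eta (val (K1center eps a)) = eta a.
Proof. by rewrite /= linearB linearZ /= coc1 scaler0 subr0. Qed.

Lemma coc_star_center a : eta (star (val (K1center eps a))) = eta (star a).
Proof.
by rewrite /= -scaleN1r scalerA starD starZ star1 linearD linearZ /= coc1 scaler0 addr0.
Qed.

(** Together with [psi], the functional that sends [a] to the conjugate of
[psi (star a)] also lifts [calK eta], because [(a b)^* = b^* a^*] and the form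
is hermitian; the average of the two is hermitian. *)
Lemma lifts_calK_hermitian (psi : {linear A -> C^o}) : lifts (calK eta) psi ->
  exists psi' : {linear A -> C^o}, hermitian_functional star psi' /\ lifts (calK eta) psi'.
Proof.
move=> [psi1 psiK].
pose h a : C := 2^-1 * ((psi a : C) + (psi (star a) : C)^*).
have hlin : linear (h : A -> C^o).
  have psiL c a b : (psi (c *: a + b) : C) = c * (psi a : C) + (psi b : C).
    exact: linearP.
  move=> c a b; rewrite /h starD starZ !psiL rmorphD rmorphM /= conjCK.
  by rewrite -[c *: _]/(c * _); ring.
pose hL : {linear A -> C^o} :=
  HB.pack (h : A -> C^o) (GRing.isLinear.Build C A C^o _ h hlin).
exists hL; split; [|split].
- move=> a; change (h (star a) = (h a)^*).
  rewrite /h starK rmorphM rmorphD /= conjCK fmorphV rmorph_nat.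
  by rewrite addrC.
- by change (h 1 = 0); rewrite /h star1 psi1 conjC0 addr0 mulr0.
- move=> x y; change (h (val x * val y) = calK eta (tensA x y)).
  have sP (z : K1 eps) : star (val z) \in kerp eps.
    by apply/eqP; rewrite char_star K1E conjC0.
  pose s (z : K1 eps) : K1 eps := exist _ (star (val z)) (sP z).
  rewrite /h starM psiK (psiK (s y) (s x)) !calKE /= starK inner_conj.
  by rewrite mulrC mulrDl -splitr.
Qed.

(** On pairs in [K1] the identity of a Schurmann triple says that [psi] lifts
[calK eta]. Conversely the identity for all pairs reduces to centered ones,
since [psi] and [eta] vanish at [1]. *)
Lemma admits_calK :
  admits_generating_functional eta <-> (forall t : K1tensor eps, mu t = 0 -> calK eta t = 0).
Proof.
split=> [[psi [_ psiE]] t mut|/lifts_exists[psi /lifts_calK_hermitian[psi' [psiH [psi1 psiK]]]]].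
  rewrite (@lifts_mu _ _ _ _ (calK eta) psi) ?mut ?linear0 // => x y.
  have := psiE (val x) (val y).
  rewrite !K1E mul0r mulr0 sub0r addr0 => /oppr_inj psixy.
  exact: etrans psixy (esym (calKE eta x y)).
exists psi'; split=> // a b; rewrite (coboundary_functional eps a b psi1) psiK calKE.
by rewrite coc_center coc_star_center.
Qed.

End Schurmann.

Local Open Scope complex_scope.

Theorem mainTheorem4 (R : realType) (A : algType R[i]) (star : star_op A)
    (eps : character star) :
  [/\ [/\ forall phi : {linear K1tensor eps -> R[i]^o},
            (exists psi : {linear A -> R[i]^o}, lifts phi psi) <->
            (forall z : HH eps 2, phi (hoch_p z) = 0),
          forall t : K1tensor eps,
            (exists z : HH eps 2, hoch_p z = t) <-> mu t = 0
        & forall (phi : {linear K1tensor eps -> R[i]^o})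
                 (psi psi' : {linear A -> R[i]^o}),
            lifts phi psi ->
            (lifts phi psi' <->
             exists h : {linear HH eps 1 -> R[i]^o},
               forall a : A, psi' a = psi a + h (HH1_class eps a))],
      (forall x : HH eps 2, x = 0) <-> (forall x : HHco eps 2, x = 0),
      forall (D : lmodType R[i]) (form : {dot D for Num.conj})
             (pi : star_rep star form) (eta : cocycle eps pi),
        admits_generating_functional eta <->
        (forall t : K1tensor eps, mu t = 0 -> calK eta t = 0)
    & (forall x : HHco eps 2, x = 0) -> property_AC eps].
Proof.
have HHdual : (forall x : HH eps 2, x = 0) <-> (forall x : HHco eps 2, x = 0).
  exact: homology_dual.
split=> // [|D form pi eta|/HHdual HH0 D form pi eta].
- split=> [phi|t|phi psi psi'].
  + split=> [/lifts_exists phimu z|phip].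
      by apply/phimu/range_hoch_p; exists z.
    by apply/lifts_exists => t /range_hoch_p[z <-].
  + exact: range_hoch_p.
  + exact: lifts_unique.
- exact: admits_calK.
- apply/admits_calK => t /range_hoch_p[z <-].
  by rewrite (HH0 z) !linear0.
Qed.
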